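(* For all integers $m,n\geq 0$, $$J^m_{n+1}=(m+1)\sum_{s=0}^{n}\binom{n}{s}J^{m+1}_s .$$
   Context: Let $X_n=\{1,\dots,n\}$. A preferential arrangement of $X_n$ is an ordered set partition: a linearly ordered sequence of pairwise disjoint nonempty subsets (blocks) whose union is $X_n$. A barred preferential arrangement of $X_n$ with $m$ bars is a preferential arrangement of $X_n$ together with $m$ indistinguishable bars inserted into the sequence of blocks (before the first block, between blocks, or after the last block, several bars possibly in the same place). Equivalently, it is a sequence of $m+1$ sections $S_1,\dots,S_{m+1}$, where the $S_i$ are pairwise disjoint, possibly empty, subsets with union $X_n$, and each $S_i$ carries a preferential arrangement of its elements. $J^m_n$ denotes the number of barred preferential arrangements of $X_n$ with $m$ bars; $J^0_n$ is the number of preferential arrangements of $X_n$, and $J^m_0=1$. *)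

(* Defs.v *)
From mathcomp Require Import all_boot.

Set Implicit Arguments.
Unset Strict Implicit.
Unset Printing Implicit Defensive.

Definition pref_arr n (s : seq {set 'I_n}) : bool :=
  [&& set0 \notin s,
      pairwise (fun A B : {set 'I_n} => [disjoint A & B]) s
    & \bigcup_(B <- s) B == [set: 'I_n]].

(* A word of blocks and bars: [Some B] is the block B, [None] is a bar. *)
Definition barred_pref_arr m n (w : seq (option {set 'I_n})) : bool :=
  (count_mem None w == m) && pref_arr (pmap id w).

Lemma pref_arr_size n (s : seq {set 'I_n}) : pref_arr s -> size s <= n.
Proof.
case/and3P=> s0 sP /eqP sT.
rewrite -[leqRHS]card_ord -cardsT -sT {sT}.
elim: s s0 sP => [|A s IHs] //=.
rewrite in_cons negb_or eq_sym => /andP[A0 s0] /andP[/allP sA sP].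
have dA : [disjoint A & \bigcup_(B <- s) B].
  rewrite disjoint_sym disjoint_subset; apply/subsetP => x.
  rewrite bigcup_seq => /bigcupP[B Bs xB]; rewrite inE.
  by have := sA B Bs; rewrite disjoint_sym => /disjointFr ->.
rewrite big_cons cardsU disjoint_setI0 // cards0 subn0 -add1n.
by apply: leq_add; [rewrite card_gt0 | apply: IHs].
Qed.

Lemma barred_pref_arr_size m n (w : seq (option {set 'I_n})) :
  barred_pref_arr m w -> size w <= n + m.
Proof.
case/andP=> /eqP <- /pref_arr_size; rewrite size_pmap => wn.
rewrite -(count_predC isSome w) leq_add //.
by apply: sub_count => -[].
Qed.

(* By [barred_pref_arr_size], bounding the length by n + m excludes no word. *)
Definition J m n : nat :=
  #|[set w : (n + m).-bseq (option {set 'I_n}) | barred_pref_arr m w]|.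

(* Main.v *)
(** Deleting the block [B] that contains the last point of [X_{n+1}] and
    putting a bar in its place turns a barred preferential arrangement with
    [m] bars into a barred preferential arrangement, with [m+1] bars one of
    which is marked, of the complement of [B], an arbitrary subset of [X_n].
    Marking one of the [m+1] bars accounts for the factor [m+1], and choosing
    the complement of [B] for the sum over [s]. *)
Require Import Defs.
From mathcomp Require Import all_boot.

Set Implicit Arguments.
Unset Strict Implicit.
Unset Printing Implicit Defensive.

(** * Cardinality comparison and replacement of a letter in a sequence *)

Lemma leq_card_can_in (T U : finType) (A : {set T}) (B : {set U})
    (f : T -> U) (g : U -> T) :
  (forall x, x \in A -> f x \in B) -> {in A, cancel f g} -> #|A| <= #|B|.
Proof.
move=> fAB fK; rewrite -(card_in_imset (can_in_inj fK)) subset_leq_card //.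
by apply/subsetP => _ /imsetP[x xA ->]; apply: fAB.
Qed.

Lemma insub_bseqK n (T : Type) (s : seq T) :
  size s <= n -> insub_bseq n s = s :> seq T.
Proof. by move=> sn; rewrite /insub_bseq insubdK. Qed.

Lemma set_nth_nth (T : Type) (x0 y : T) (s : seq T) i :
  i < size s -> set_nth x0 (set_nth x0 s i y) i (nth x0 s i) = s.
Proof.
move=> si; have sizeE z t : i < size t -> size (set_nth x0 t i z) = size t.
  by move=> it; rewrite size_set_nth; apply/maxn_idPr.
apply: (@eq_from_nth _ x0) => [|j _]; first by rewrite !sizeE ?sizeE.
by rewrite !nth_set_nth /= nth_set_nth /=; case: eqP => // ->.
Qed.

(** The additive form keeps truncated subtraction out of all later letter counts. *)
Lemma count_set_nthD (T : Type) (a : pred T) (x0 y : T) (s : seq T) i :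
  i < size s -> count a (set_nth x0 s i y) + a (nth x0 s i) = count a s + a y.
Proof.
move=> si; rewrite count_set_nth_ltn // subnK //.
case: (boolP (a (nth x0 s i))) => // ai; apply: ltn_addr.
by rewrite -has_count; apply/(has_nthP x0); exists i.
Qed.

(** * Barred arrangements of a subset of a finite type, by counting *)

Section BarredArrangementsOfSets.
Variable T : finType.
Implicit Types (A B : {set T}) (w : seq (option {set T})) (o : option {set T}).

Definition in_block (y : T) o : bool := if o is Some B then y \in B else false.

Definition cover_word w : {set T} := [set y | has (in_block y) w].

(* Disjointness of the blocks and the fact that they cover [A] are expressed
   together by counting, which is additive under changes of single letters. *)
Definition barred_arr A m w : bool :=
  [&& count_mem None w == m, count_mem (Some set0) w == 0
    & [forall y, count (in_block y) w == (y \in A)]].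

Lemma barred_arrP A m w :
  reflect [/\ count_mem None w = m, count_mem (Some set0) w = 0
            & forall y, count (in_block y) w = (y \in A)]
          (barred_arr A m w).
Proof.
apply: (iffP and3P) => [[/eqP ? /eqP ? /forallP h]|[-> -> h]].
  by split=> // y; apply/eqP.
by split=> //; apply/forallP => y; rewrite h.
Qed.

(** A word thus arranges at most one set, which allows words to be sorted by the set they cover. *)
Lemma cover_wordE A m w : barred_arr A m w -> cover_word w = A.
Proof.
case/barred_arrP=> _ _ h; apply/setP => y.
by rewrite inE has_count h lt0b.
Qed.

(** Disjointness says that each point lies in at most one block, and covering says which points lie
    in at least one. *)
Lemma pairwise_disjointE A (s : seq {set T}) :
  pairwise (fun B C : {set T} => [disjoint B & C]) s && (\bigcup_(B <- s) B == A)
  = [forall y, count (fun B : {set T} => y \in B) s == (y \in A)].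
Proof.
have cupP y : (y \in \bigcup_(B <- s) B) = has (fun B : {set T} => y \in B) s.
  elim: s => [|B s IH]; first by rewrite big_nil inE.
  by rewrite big_cons inE IH.
apply/andP/forallP => [[sP /eqP <-] y|h].
  apply/eqP; rewrite cupP {cupP A}.
  elim: s sP => //= B s IH /andP[/allP Bs /IH ->].
  case: (boolP (y \in B)) => //= yB.
  case: hasP => // -[C /Bs BC yC].
  by rewrite (disjointFr BC yB) in yC.
split; last first.
  by apply/eqP/setP => y; rewrite cupP has_count (eqP (h y)) lt0b.
(* Only the upper bound is kept: unlike the equality with [y \in A], it passes to the tail of [s] in
   the induction. *)
have {h cupP} : forall y, count (fun B : {set T} => y \in B) s <= 1.
  by move=> y; rewrite (eqP (h y)) leq_b1.
elim: s => //= B s IH h; apply/andP; split; last first.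
  by apply: IH => y; apply: leq_trans (h y); rewrite leq_addl.
apply/allP => C Cs; rewrite disjoint_subset; apply/subsetP => y yB.
rewrite inE; apply/negP => yC; have := h y; rewrite yB leqNgt ltnS.
by rewrite -has_count => /hasP; case; exists C.
Qed.

End BarredArrangementsOfSets.

Lemma barred_pref_arrE m n (w : seq (option {set 'I_n})) :
  barred_pref_arr m w = barred_arr setT m w.
Proof.
rewrite /barred_pref_arr /pref_arr /barred_arr pairwise_disjointE.
have E (a : pred {set 'I_n}) :
    count a (pmap id w) = count (fun o => if o is Some B then a B else false) w.
  by elim: w => //= -[B|] w /= ->.
congr [&& _, _ & _]; last by apply: eq_forallb => y; rewrite E.
by rewrite -has_pred1 has_count -eqn0Ngt E; congr (_ == 0); apply: eq_count => -[].
Qed.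

(** * Independence of the count from the ground set and the length bound *)

Section Transport.
Variables (T : finType) (A : {set T}).
Implicit Types (w : seq (option {set T})) (v : seq (option {set 'I_#|A|})).

Let val_letter : option {set 'I_#|A|} -> option {set T} :=
  omap (fun B : {set 'I_#|A|} => [set enum_val i | i in B]).
Let pre_letter : option {set T} -> option {set 'I_#|A|} :=
  omap (fun B : {set T} => [set i | enum_val i \in B]).

Let val_letterK : cancel val_letter pre_letter.
Proof.
case=> [B|] //=; congr Some; apply/setP => i.
by rewrite inE (mem_imset _ _ enum_val_inj).
Qed.

Let in_val_letter i o : in_block (enum_val i) (val_letter o) = in_block i o.
Proof. by case: o => //= B; rewrite (mem_imset _ _ enum_val_inj). Qed.

Let notin_val_letter y o : y \notin A -> in_block y (val_letter o) = false.
Proof.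
case: o => //= B yA; apply/imsetP => -[i _ yE].
by rewrite yE enum_valP in yA.
Qed.

Lemma barred_arr_map m v :
  barred_arr A m (map val_letter v) = barred_arr setT m v.
Proof.
rewrite /barred_arr !count_map; congr [&& _, _ & _].
- by congr (_ == _); apply: eq_count => -[].
- congr (_ == _); apply: eq_count => o /=.
  by rewrite -[RHS](inj_eq (can_inj val_letterK)) /= imset0.
apply/forallP/forallP => h x; have := h.
  move=> /(_ (enum_val x)); rewrite count_map enum_valP inE.
  by rewrite (eq_count (in_val_letter x)).
case: (boolP (x \in A)) => xA _; rewrite count_map.
  rewrite -(enum_rankK_in xA xA) (eq_count (in_val_letter _)).
  by have := h (enum_rank_in xA x); rewrite inE.
by rewrite (eq_count (a2 := pred0)) ?count_pred0 // => o; apply: notin_val_letter.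
Qed.

(** Pulling back along [enum_val] loses the points outside [A], but the counting condition forces
    every block of [w] into [A]. *)
Lemma barred_arr_preK m w : barred_arr A m w -> map val_letter (map pre_letter w) = w.
Proof.
case/barred_arrP=> _ _ h; rewrite -map_comp map_id_in // => -[B|] //= Bw.
congr Some; apply/setP => y; apply/imsetP/idP => [[i]|yB].
  by rewrite inE => iB ->.
have yA : y \in A.
  by rewrite -[_ \in _]lt0b -h -has_count; apply/hasP; exists (Some B).
by exists (enum_rank_in yA y); rewrite ?inE enum_rankK_in.
Qed.

Lemma barred_arr_size m w : barred_arr A m w -> size w <= #|A| + m.
Proof.
move=> wA; rewrite -(size_map pre_letter) barred_pref_arr_size //.
by rewrite barred_pref_arrE -barred_arr_map (barred_arr_preK wA).
Qed.

(** A free bound [k] lets words over subsets [A] of different sizes be counted in one common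
    type. *)
Lemma card_barred_arr m k : #|A| + m <= k ->
  #|[set w : k.-bseq (option {set T}) | barred_arr A m w]| = J m #|A|.
Proof.
move=> leAk.
pose f (w : k.-bseq (option {set T})) :=
  insub_bseq (#|A| + m) (map pre_letter w).
pose g (v : (#|A| + m).-bseq (option {set 'I_#|A|})) :=
  insub_bseq k (map val_letter v).
have gE (v : (#|A| + m).-bseq _) : g v = map val_letter v :> seq _.
  by rewrite insub_bseqK // size_map (leq_trans (size_bseq v)).
have fE (w : k.-bseq _) : barred_arr A m w -> f w = map pre_letter w :> seq _.
  by move=> wA; rewrite insub_bseqK // size_map barred_arr_size.
apply/eqP; rewrite eqn_leq; apply/andP; split.
  apply: (@leq_card_can_in _ _ _ _ f g) => w /[!inE] wA.
    by rewrite barred_pref_arrE -barred_arr_map fE ?(barred_arr_preK wA).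
  by apply: val_inj; rewrite /= gE fE // (barred_arr_preK wA).
apply: (@leq_card_can_in _ _ _ _ g f) => v /[!inE] /[!barred_pref_arrE] vA.
  by rewrite gE barred_arr_map.
by apply: val_inj; rewrite /= fE gE ?barred_arr_map // (mapK val_letterK).
Qed.

End Transport.

(** * The correspondence between arrangements and marked bars *)

Section Marking.
Variables (T : finType) (x : T) (m : nat).
Implicit Types (w : seq (option {set T})).

(* The default letter [Some set0] is neither a bar nor a legal block, so
   [nth] detects bars without a separate bound on the position. *)
Local Notation E0 := (Some (@set0 T)).

(** The erased block need not be recorded: it is the complement of what the remaining blocks
    cover. *)
Let fill w i := set_nth E0 w i (Some (~: cover_word w)).
Let erase w := set_nth E0 w (find (in_block x) w) None.

(** The ground set is left implicit as [cover_word w], so one predicate gathers the words over all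
    subsets avoiding [x]. *)
Definition marked_bar w i : bool :=
  [&& barred_arr (cover_word w) m.+1 w, cover_word w \subset ~: [set x]
    & nth E0 w i == None].

Lemma marked_bar_size w i : marked_bar w i -> i < size w.
Proof. by case/and3P=> _ _; case: ltnP => // wi; rewrite nth_default. Qed.

Let size_fill w i : marked_bar w i -> size (fill w i) = size w.
Proof. by move/marked_bar_size=> iw; rewrite size_set_nth; apply/maxn_idPr. Qed.

Let fill_arr w i : marked_bar w i -> barred_arr setT m (fill w i).
Proof.
move=> wi; have iw := marked_bar_size wi.
have {wi} [/barred_arrP[h1 h2 h3] xw /eqP wi] := and3P wi.
have D a := count_set_nthD a E0 (Some (~: cover_word w)) iw.
apply/barred_arrP; split=> [||y].
- by have := D (pred1 None); rewrite wi h1 /= addn1 addn0 => -[].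
(* The inserted block contains [x], hence is not empty. *)
- have := D (pred1 E0); rewrite wi h2 /= addn0 add0n => ->.
  rewrite -[Some _ == _]/(~: cover_word w == set0); apply/eqP; rewrite eqb0.
  by apply/set0Pn; exists x; rewrite subsetC sub1set in xw.
- have := D (in_block y); rewrite wi h3 /= addn0 => ->.
  by rewrite !inE; case: has.
Qed.

(** Since [x] lies in no block of [w], the inserted block is the only one containing it, and
    searching for [x] recovers the mark. *)
Let find_fill w i : marked_bar w i -> find (in_block x) (fill w i) = i.
Proof.
move=> wi; have iw := marked_bar_size wi.
have {wi} [_ xw _] := and3P wi.
rewrite subsetC sub1set !inE in xw.
rewrite /fill set_nthE iw find_cat size_takel ?(ltnW iw) //= !inE xw addn0.
case: ifP => // h; case/negP: xw; move/hasP: h => [o /mem_take ow xo].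
by apply/hasP; exists o.
Qed.

Let fillK w i : marked_bar w i -> erase (fill w i) = w.
Proof.
move=> wi; rewrite /erase find_fill //; have iw := marked_bar_size wi.
by have [_ _ /eqP <-] := and3P wi; rewrite set_nth_nth.
Qed.

Let find_lt w : barred_arr setT m w -> find (in_block x) w < size w.
Proof. by case/barred_arrP=> _ _ h; rewrite -has_find has_count h inE. Qed.

Let size_erase w : barred_arr setT m w -> size (erase w) = size w.
Proof. by move/find_lt=> iw; rewrite size_set_nth; apply/maxn_idPr. Qed.

Let nth_find w : barred_arr setT m w ->
  exists2 B, nth E0 w (find (in_block x) w) = Some B & x \in B.
Proof.
move=> wT; have : has (in_block x) w by rewrite has_find find_lt.
by move/(nth_find E0); case: nth => //= B xB; exists B.
Qed.

Let count_erase w (wT : barred_arr setT m w) B a :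
  nth E0 w (find (in_block x) w) = Some B ->
  count a (erase w) + a (Some B) = count a w + a None.
Proof. by move=> <-; apply: count_set_nthD; apply: find_lt. Qed.

Let count_block_erase w (wT : barred_arr setT m w) B :
  nth E0 w (find (in_block x) w) = Some B ->
  forall y, count (in_block y) (erase w) = (y \notin B).
Proof.
move=> wB y; have := count_erase wT (in_block y) wB.
have /barred_arrP[_ _ ->] := wT; rewrite inE /= addn0.
by case: (y \in B); rewrite ?addn0 // addn1 => -[].
Qed.

Let cover_erase w (wT : barred_arr setT m w) B :
  nth E0 w (find (in_block x) w) = Some B -> cover_word (erase w) = ~: B.
Proof.
move=> wB; apply/setP => y.
by rewrite !inE has_count (count_block_erase wT wB) lt0b.
Qed.

Let erase_marked w :
  barred_arr setT m w -> marked_bar (erase w) (find (in_block x) w).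
Proof.
move=> wT; have [B wB xB] := nth_find wT.
rewrite /marked_bar (cover_erase wT wB) setCS sub1set xB nth_set_nth /= eqxx.
rewrite andbT; apply/barred_arrP.
have /barred_arrP[h1 h2 _] := wT; split=> [||y].
- by have := count_erase wT (pred1 None) wB; rewrite h1 /= addn0 addn1.
- have := count_erase wT (pred1 E0) wB; rewrite h2 /= => /eqP.
  by rewrite addn_eq0 => /andP[/eqP].
- by rewrite (count_block_erase wT wB) inE.
Qed.

Let eraseK w : barred_arr setT m w -> fill (erase w) (find (in_block x) w) = w.
Proof.
move=> wT; have [B wB _] := nth_find wT.
by rewrite /fill (cover_erase wT wB) setCK -wB set_nth_nth ?find_lt.
Qed.

(** [fill] and [erase] are mutually inverse and preserve length, so the same bound serves both
    sides; positions are below the length, hence fit in ['I_k.+1]. *)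
Lemma card_marked_bar k :
  #|[set w : k.+1.-bseq (option {set T}) | barred_arr setT m w]|
  = #|[set u : k.+1.-bseq (option {set T}) * 'I_k.+1 | marked_bar u.1 u.2]|.
Proof.
pose f (w : k.+1.-bseq (option {set T})) : _ * 'I_k.+1 :=
  (insub_bseq k.+1 (erase w), inord (find (in_block x) w)).
pose g (u : k.+1.-bseq (option {set T}) * 'I_k.+1) :=
  insub_bseq k.+1 (fill u.1 u.2).
have fE (w : k.+1.-bseq _) : barred_arr setT m w ->
    ((f w).1 = erase w :> seq _) * ((f w).2 = find (in_block x) w :> nat).
  move=> wT; rewrite insub_bseqK ?size_erase ?size_bseq // inordK //.
  by apply: leq_trans (find_lt wT) (size_bseq w).
have gE (u : k.+1.-bseq _ * 'I_k.+1) : marked_bar u.1 u.2 -> g u = fill u.1 u.2 :> seq _.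
  by move=> um; rewrite insub_bseqK ?size_fill ?size_bseq.
apply/eqP; rewrite eqn_leq; apply/andP; split.
  apply: (@leq_card_can_in _ _ _ _ f g) => w /[!inE] wT.
    by rewrite !(fE w) // erase_marked.
  by apply: val_inj; rewrite /= gE !(fE w) ?eraseK ?erase_marked.
apply: (@leq_card_can_in _ _ _ _ g f) => u /[!inE] um.
  by rewrite gE // fill_arr.
have gT : barred_arr setT m (g u) by rewrite gE ?fill_arr.
rewrite [f _]surjective_pairing [RHS]surjective_pairing; congr (_, _).
  by apply: val_inj; rewrite /= fE // gE // fillK.
by apply: val_inj; rewrite /= fE // gE // find_fill.
Qed.

(** Double counting: each word admits one mark per bar, that is [m.+1] marks, and the words are then
    grouped by the set they cover. *)
Lemma sum_marked_bar k :
  #|[set u : k.+1.-bseq (option {set T}) * 'I_k.+1 | marked_bar u.1 u.2]|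
  = \sum_(A : {set T} | A \subset ~: [set x])
      m.+1 * #|[set w : k.+1.-bseq (option {set T}) | barred_arr A m.+1 w]|.
Proof.
pose P w := barred_arr (cover_word w) m.+1 w && (cover_word w \subset ~: [set x]).
transitivity (\sum_(w : k.+1.-bseq (option {set T}) | P w) m.+1).
  rewrite -sum1dep_card; under eq_bigl do rewrite /marked_bar andbA.
  rewrite -(pair_big_dep (fun w : k.+1.-bseq _ => P w)
    (fun (w : k.+1.-bseq _) (i : 'I_k.+1) => nth E0 w i == None) (fun _ _ => 1)) /=.
  apply: eq_bigr => w /andP[/barred_arrP[<- _ _] _].
  rewrite -sum1_count (big_nth E0) big_mkord.
  (* Positions past the end of [w] read the default [E0], which is not a bar, so the range may grow
     to [k.+1]. *)
  rewrite [RHS](big_ord_widen_cond k.+1 (fun i => nth E0 w i == None) (fun=> 1))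
    ?size_bseq //; apply: eq_bigl => i.
  by case: ltnP => wi; rewrite ?andbT ?andbF // nth_default.
rewrite (partition_big (fun w : k.+1.-bseq _ => cover_word w)
  (fun A => A \subset ~: [set x])) => [|w /andP[]//].
apply: eq_bigr => A Ax; rewrite mulnC -sum_nat_const; apply: eq_bigl => w.
rewrite inE; apply/andP/idP => [[/andP[wA _] /eqP <-] //|wA].
by rewrite /P (cover_wordE wA) wA Ax eqxx.
Qed.

End Marking.

(** * Grouping subsets by cardinality, and the recurrence *)

Lemma sum_subset_card (T : finType) (D : {set T}) (F : nat -> nat) :
  \sum_(A : {set T} | A \subset D) F #|A|
  = \sum_(0 <= s < #|D|.+1) 'C(#|D|, s) * F s.
Proof.
rewrite big_mkord (partition_big (fun A : {set T} => inord #|A| : 'I_#|D|.+1) predT) //=.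
apply: eq_bigr => s _; rewrite -cards_draws -sum_nat_const.
(* The truncation by [inord] is harmless, as a subset of [D] has at most [#|D|] elements. *)
have cE (A : {set T}) : A \subset D -> (inord #|A| == s) = (#|A| == s).
  by move=> AD; rewrite -val_eqE /= inordK // ltnS subset_leq_card.
apply: eq_big => [A|A /andP[AD]]; last by rewrite cE // => /eqP ->.
by rewrite inE; case: (boolP (A \subset D)) => //= /cE.
Qed.

Theorem theorem1 (m n : nat) :
  J m n.+1 = m.+1 * \sum_(0 <= s < n.+1) 'C(n, s) * J m.+1 s.
Proof.
have cD : #|~: [set (@ord_max n)]| = n by rewrite cardsC1 card_ord.
rewrite /J; under eq_finset do rewrite barred_pref_arrE.
rewrite (card_marked_bar ord_max) sum_marked_bar -big_distrr /=; congr (_ * _).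
have := sum_subset_card (~: [set @ord_max n]) (J m.+1); rewrite cD => <-.
apply: eq_bigr => A AD; apply: card_barred_arr.
(* The set [A] misses the last point, which makes room for the extra bar within the length bound of
   [J m n.+1]. *)
by rewrite addnS ltnS leq_add2r -[leqRHS]cD subset_leq_card.
Qed.
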